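(* Let $M(A,Q,\xi,\eta,g)$ be a weak a.c.m. manifold with $F(X,Y)=g(AX,Y)$, considered as a generalized Riemannian manifold $(M,G=g+F)$, and let $\nabla$ be an Einstein's connection with totally skew-symmetric torsion $T$ satisfying the $A$-torsion condition $T(AX,Y,Z)=T(X,AY,Z)=T(X,Y,AZ)$ for all $X,Y,Z$. Then the following properties hold: (i) The contact distribution $\mathcal D=\ker\eta$ is involutive and the Reeb vector field $\xi$ is parallel with respect to the Levi-Civita connection $\nabla^g$. (ii) The tensor $N^{\mathrm{wac}}_A$ is totally skew-symmetric and $N^{\mathrm{wac}}_A(\cdot,\cdot,\xi)=0$. (iii) The tensor $N^{(5)}$ is totally skew-symmetric and is given by $$N^{(5)}(X,Y,Z)=-\frac13dF(X,Y,Z)-\frac13dF(X,AY,AZ).$$ (iv) The tensor $Q$ satisfies $\nabla^gQ=\nabla Q=0$.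
   Context: A weak almost contact metric (a.c.m.) manifold $M(A,Q,\xi,\eta,g)$ is a $(2m+1)$-dimensional Riemannian manifold $(M,g)$ with a $g$-skew-symmetric $(1,1)$-tensor $A$ of rank $2m$, a unit vector field $\xi$ (Reeb field), its dual 1-form $\eta(X)=g(X,\xi)$, $\eta(\xi)=1$, and a $g$-self-adjoint $(1,1)$-tensor $Q>0$ (positive definite), such that $A^2=-Q+\eta\otimes\xi$, $g(AX,AY)=g(QX,Y)-\eta(X)\eta(Y)$, $A\xi=0$, $Q\xi=\xi$. Convention: the letters $X,Y,Z$ denote smooth vector fields that pairwise commute. For a linear connection $\nabla$, $T(X,Y)=\nabla_XY-\nabla_YX-[X,Y]$ and $T(X,Y,Z):=g(T(X,Y),Z)$; it is totally skew-symmetric if $T(X,Y,Z)$ is skew-symmetric in all arguments. With $G=g+F$, an Einstein's connection is a linear connection $\nabla$ satisfying the Einstein metricity condition $XG(Y,Z)-G(\nabla_YX,Z)-G(Y,\nabla_XZ)=0$; equivalently, $(\nabla_XG)(Y,Z)=-G(T(X,Y),Z)$ for all $X,Y,Z$. $d$ is normalized without factors: $d\eta(X,Y)=g(\nabla^g_X\xi,Y)-g(\nabla^g_Y\xi,X)$, and for commuting fields $dF(X,Y,Z)=X(F(Y,Z))+Y(F(Z,X))+Z(F(X,Y))$. With $N_A(X,Y)=[AX,AY]+A^2[X,Y]-A[AX,Y]-A[X,AY]$ and $N_A(X,Y,Z)=g(N_A(X,Y),Z)$, the Nijenhuis tensor in weak a.c.m. geometry is the $(0,3)$-tensor $N^{\mathrm{wac}}_A=N_A+d\eta\otimes\eta$,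 i.e. $N^{\mathrm{wac}}_A(X,Y,Z)=N_A(X,Y,Z)+d\eta(X,Y)\eta(Z)$. With $\widetilde Q=Q-\mathrm{Id}$, the tensor $N^{(5)}$, skew-symmetric with respect to $Y$ and $Z$, is defined by $$N^{(5)}(X,Y,Z)=(AZ)\big(g(X,\widetilde QY)\big)-(AY)\big(g(X,\widetilde QZ)\big)+g([X,AZ],\widetilde QY)-g([X,AY],\widetilde QZ)+g\big([Y,AZ]-[Z,AY]-A[Y,Z],\widetilde QX\big).$$
   Formalization: The displayed five-term N^(5) is not a tensor and (iii) fails for it even for commuting fields; the formal statement adds the term X(g(AY, Q̃Z)) to the definition of N^(5), which makes it a tensor, and proves (iii) with the stated coefficients. *)

(* Defs.v *)
From HB Require Import structures.
From mathcomp Require Import all_boot all_order all_algebra.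
From mathcomp Require Import all_classical all_reals all_analysis.
From mathcomp Require Import ring.
Import numFieldNormedType.Exports.
Import Order.TTheory GRing.Theory Num.Theory.
Set Implicit Arguments.
Unset Strict Implicit.
Unset Printing Implicit Defensive.
Local Open Scope classical_set_scope.
Local Open Scope ring_scope.

Section Smooth.
Context {R : realType} {n : nat}.
Implicit Types (U : set 'rV[R]_n) (f g : 'rV[R]_n -> R).

Fixpoint ck_on (k : nat) U f : Prop :=
  (forall x, U x -> {for x, continuous f}) /\
  if k is k'.+1 then
    (forall x v, U x -> derivable f x v) /\ (forall v, ck_on k' U ('D_v f))
  else True.

Definition smooth_on U f := forall k, ck_on k U f.

Let nearE U f g : open U -> (forall x, U x -> f x = g x) ->
  forall x, U x -> \forall y \near x, f y = g y.
Proof.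
move=> oU fg x Ux; apply: (@filterS _ _ _ U); first by move=> y; exact: fg.
exact: open_nbhs_nbhs.
Qed.

Lemma ck_on_ext k U f g : open U -> (forall x, U x -> f x = g x) ->
  ck_on k U f -> ck_on k U g.
Proof.
move=> oU; elim: k f g => [|k IH] f g fg /= [cf df].
  split=> // x Ux; have fgx := nearE oU fg Ux.
  have := cf x Ux; rewrite /prop_for /continuous_at (fg x Ux) => cfx.
  exact: (cvg_trans (@near_eq_cvg _ _ (nbhs x) _ _ _ fgx) cfx).
split.
  move=> x Ux; have fgx := nearE oU fg Ux.
  have := cf x Ux; rewrite /prop_for /continuous_at (fg x Ux) => cfx.
  exact: (cvg_trans (@near_eq_cvg _ _ (nbhs x) _ _ _ fgx) cfx).
case: df => df Df; split.
  move=> x v Ux.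
  by apply: near_eq_derivable (nearE oU fg Ux) (df x v Ux).
move=> v; apply: (IH ('D_v f) ('D_v g) _ (Df v)) => x Ux.
exact: near_eq_derive (nearE oU fg Ux).
Qed.

Lemma ck_on_cst k U (c : R) : ck_on k U (cst c).
Proof.
elim: k c => [|k IH] c /=;
  (split; first by move=> x _; exact: cst_continuous) => //.
split=> [x v _|v]; first exact: derivable_cst.
by rewrite (_ : 'D_v (cst c) = cst 0) //; apply/funext => x; rewrite derive_cst.
Qed.

Lemma ck_onW k U f : ck_on k.+1 U f -> ck_on k U f.
Proof.
elim: k f => [|k IH] f [cf [df Df]]; first by split.
by split=> //; split=> // v; exact: IH.
Qed.

Lemma ck_onD k U f g : open U -> ck_on k U f -> ck_on k U g ->
  ck_on k U (f \+ g).
Proof.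
move=> oU; elim: k f g => [|k IH] f g /= [cf df] [cg dg].
  by split=> // x Ux; apply: continuousD; [exact: cf|exact: cg].
split; first by move=> x Ux; apply: continuousD; [exact: cf|exact: cg].
case: df dg => df Df [dg Dg]; split=> [x v Ux|v].
  by apply: derivableD; [exact: df|exact: dg].
apply: ck_on_ext oU _ (IH _ _ (Df v) (Dg v)) => x Ux /=.
by rewrite deriveD //; [exact: df|exact: dg].
Qed.

Lemma ck_onM k U f g : open U -> ck_on k U f -> ck_on k U g ->
  ck_on k U (f \* g).
Proof.
move=> oU; elim: k f g => [|k IH] f g Hf Hg.
  case: Hf Hg => cf _ [cg _].
  by split=> // x Ux; apply: continuousM; [exact: cf|exact: cg].
have [Hf' Hg'] := (ck_onW Hf, ck_onW Hg).
case: Hf Hg => cf [df Df] [cg [dg Dg]].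
split; first by move=> x Ux; apply: continuousM; [exact: cf|exact: cg].
split=> [x v Ux|v]; first by apply: derivableM; [exact: df|exact: dg].
apply: ck_on_ext oU _ (ck_onD oU (IH _ _ Hf' (Dg v)) (IH _ _ (Df v) Hg')).
move=> x Ux /=; rewrite deriveM; [|exact: df|exact: dg].
by congr (_ + _); rewrite mulrC.
Qed.

End Smooth.

(* [chart_map] and [chart_inv] are total; only their values on [chart_dom] and
   its image are meaningful. *)
Record chart (R : realType) (n : nat) (M : topologicalType) := Chart {
  chart_dom : set M;
  chart_map : M -> 'rV[R]_n;
  chart_inv : 'rV[R]_n -> M;
  chart_open_dom : open chart_dom;
  chart_open_img : open (chart_map @` chart_dom);
  chart_mapK : forall p, chart_dom p -> chart_inv (chart_map p) = p;
  chart_map_continuous : {within chart_dom, continuous chart_map};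
  chart_inv_continuous :
    {within chart_map @` chart_dom, continuous chart_inv} }.

Definition chart_compatible (R : realType) (n : nat) (M : topologicalType)
    (c c' : chart R n M) :=
  forall i : 'I_n, smooth_on (chart_map c @` (chart_dom c `&` chart_dom c'))
    (fun x => chart_map c' (chart_inv c x) 0 i).

Record manifold (R : realType) (n : nat) := Manifold {
  points :> topologicalType;
  manifold_hausdorff : hausdorff_space points;
  manifold_second_countable : @second_countable points;
  atlas : set (chart R n points);
  atlas_cover : forall p, exists2 c, atlas c & chart_dom c p;
  atlas_compatible : forall c c', atlas c -> atlas c' ->
    chart_compatible c c' }.

Section SmoothFunctions.
Context {R : realType} {n : nat}.
Variable M : manifold R n.

Definition is_smooth (f : M -> R) := forall c, atlas c ->
  smooth_on (chart_map c @` chart_dom c) (f \o chart_inv c).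

Definition smooth_pred : {pred M -> R} := fun f => `[< is_smooth f >].

Lemma is_smooth_cst a : is_smooth (cst a).
Proof. by move=> c _ k; exact: ck_on_cst. Qed.

Lemma is_smoothD f g : is_smooth f -> is_smooth g -> is_smooth (f + g).
Proof.
move=> sf sg c cM k.
exact: (ck_onD (@chart_open_img _ _ _ c) (sf c cM k) (sg c cM k)).
Qed.

Lemma is_smoothM f g : is_smooth f -> is_smooth g -> is_smooth (f * g).
Proof.
move=> sf sg c cM k.
exact: (ck_onM (@chart_open_img _ _ _ c) (sf c cM k) (sg c cM k)).
Qed.

Lemma is_smoothZ a f : is_smooth f -> is_smooth (a *: f).
Proof. by move=> sf; apply: (is_smoothM (is_smooth_cst a)). Qed.

Fact smooth_subring : subring_closed smooth_pred.
Proof.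
split=> [|f g|f g]; first exact/asboolP/is_smooth_cst.
- move=> /asboolP sf /asboolP sg; apply/asboolP.
  by rewrite -[- g]scaleN1r; exact/is_smoothD/is_smoothZ.
- by move=> /asboolP sf /asboolP sg; exact/asboolP/is_smoothM.
Qed.
HB.instance Definition _ :=
  GRing.isSubringClosed.Build (M -> R) smooth_pred smooth_subring.

Fact smooth_scaler : scaler_closed smooth_pred.
Proof. by move=> a f /asboolP sf; exact/asboolP/is_smoothZ. Qed.
HB.instance Definition _ :=
  GRing.isScaleClosed.Build R (M -> R) smooth_pred smooth_scaler.

Record smoothFun := SmoothFun { sfun :> M -> R; _ : sfun \in smooth_pred }.

HB.instance Definition _ := [isSub for sfun].
HB.instance Definition _ := [Choice of smoothFun by <:].
HB.instance Definition _ := 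
  GRing.SubChoice_isSubComPzRing.Build (M -> R) smooth_pred smoothFun
    (GRing.subringClosedP _).
HB.instance Definition _ := [SubZmodule_isSubLmodule of smoothFun by <:].

Lemma smoothFunP (f g : smoothFun) : (forall p, f p = g p) -> f = g.
Proof. by move=> fg; apply/val_inj/funext. Qed.

End SmoothFunctions.

(* Vector fields are encoded as the derivations of the R-algebra C^oo(M), and
   tensor fields as C^oo(M)-multilinear maps on vector fields. *)
Section VectorFields.
Context {R : realType} {n : nat}.
Variable M : manifold R n.
Local Notation C := (smoothFun M).

Record vectorField := VectorField {
  vf :> C -> C;
  vf_linear : forall (a : R) (f g : C), vf (a *: f + g) = a *: vf f + vf g;
  vf_leibniz : forall f g : C, vf (f * g) = vf f * g + f * vf g }.

HB.instance Definition _ := gen_eqMixin vectorField.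
HB.instance Definition _ := gen_choiceMixin vectorField.

Implicit Types (X Y Z : vectorField) (f g h : C).

Lemma vectorFieldP X Y : (forall f, X f = Y f) -> X = Y.
Proof.
case: X Y => [x xl xm] [y yl ym] /= xy; have {}xy : x = y by apply/funext.
by subst y; congr VectorField; exact: Prop_irrelevance.
Qed.

Fact vf0_linear (a : R) f g : 0 = a *: 0 + 0 :> C.
Proof. by rewrite scaler0 addr0. Qed.
Fact vf0_leibniz f g : 0 = 0 * g + f * 0 :> C.
Proof. by rewrite mul0r mulr0 addr0. Qed.
Definition vf0 := VectorField vf0_linear vf0_leibniz.

Fact vfD_linear X Y (a : R) f g :
  X (a *: f + g) + Y (a *: f + g) = a *: (X f + Y f) + (X g + Y g).
Proof. by rewrite !vf_linear scalerDr addrACA. Qed.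
Fact vfD_leibniz X Y f g :
  X (f * g) + Y (f * g) = (X f + Y f) * g + f * (X g + Y g).
Proof. by rewrite !vf_leibniz mulrDl mulrDr addrACA. Qed.
Definition vfD X Y := VectorField (vfD_linear X Y) (vfD_leibniz X Y).

Fact mulCZr (a : R) f g : f * (a *: g) = a *: (f * g).
Proof. by apply: smoothFunP => p /=; rewrite mulrCA. Qed.

Fact vfZ_linear h X (a : R) f g :
  h * X (a *: f + g) = a *: (h * X f) + h * X g.
Proof. by rewrite vf_linear mulrDr mulCZr. Qed.
Fact vfZ_leibniz h X f g : h * X (f * g) = h * X f * g + f * (h * X g).
Proof. by rewrite vf_leibniz mulrDr mulrA [h * (f * _)]mulrCA. Qed.
Definition vfZ h X := VectorField (vfZ_linear h X) (vfZ_leibniz h X).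

Fact vfDA : associative vfD.
Proof. by move=> X Y Z; apply: vectorFieldP => f /=; rewrite addrA. Qed.
Fact vfDC : commutative vfD.
Proof. by move=> X Y; apply: vectorFieldP => f /=; rewrite addrC. Qed.
Fact vf0D : left_id vf0 vfD.
Proof. by move=> X; apply: vectorFieldP => f /=; rewrite add0r. Qed.
Fact vfND : left_inverse vf0 (vfZ (-1)) vfD.
Proof. by move=> X; apply: vectorFieldP => f /=; rewrite mulN1r addNr. Qed.
HB.instance Definition _ :=
  GRing.isZmodule.Build vectorField vfDA vfDC vf0D vfND.

Fact vfZA f g X : vfZ f (vfZ g X) = vfZ (f * g) X.
Proof. by apply: vectorFieldP => h /=; rewrite mulrA. Qed.
Fact vf1Z : left_id 1 vfZ.
Proof. by move=> X; apply: vectorFieldP => h /=; rewrite mul1r. Qed.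
Fact vfZDr : right_distributive vfZ +%R.
Proof. by move=> f X Y; apply: vectorFieldP => h /=; rewrite mulrDr. Qed.
Fact vfZDl X : {morph vfZ^~ X : f g / f + g}.
Proof. by move=> f g; apply: vectorFieldP => h /=; rewrite mulrDl. Qed.
HB.instance Definition _ :=
  GRing.Zmodule_isLmodule.Build C vectorField vfZA vf1Z vfZDr vfZDl.

Fact vf_is_additive X : zmod_morphism X.
Proof.
move=> f g; have := vf_linear X (-1) g f.
by rewrite !scaleN1r addrC => ->; rewrite addrC.
Qed.
HB.instance Definition _ X := GRing.isZmodMorphism.Build C C X (vf_is_additive X).

Fact vf_additiveD X f g : X (f + g) = X f + X g.
Proof. exact: raddfD. Qed.

Fact lie_linear X Y (a : R) f g :
  X (Y (a *: f + g)) - Y (X (a *: f + g)) =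
  a *: (X (Y f) - Y (X f)) + (X (Y g) - Y (X g)).
Proof. by rewrite !vf_linear scalerBr opprD addrACA. Qed.
Fact lie_leibniz X Y f g : X (Y (f * g)) - Y (X (f * g)) =
  (X (Y f) - Y (X f)) * g + f * (X (Y g) - Y (X g)).
Proof.
rewrite !vf_leibniz !vf_additiveD !vf_leibniz; ring.

Qed.
Definition lie X Y := VectorField (lie_linear X Y) (lie_leibniz X Y).

Definition vanishes_at (p : M) X := forall f, X f p = 0.

Definition indep_at (p : M) (k : nat) (X : 'I_k -> vectorField) :=
  forall c : 'I_k -> R,
    (forall f, \sum_(i < k) c i * X i f p = 0) -> forall i, c i = 0.

(* The values of X at p range over the whole tangent space at p, so the rank of
   A at p is the maximal number of independent values of A X at p. *)
Definition has_rank (A : vectorField -> vectorField) (r : nat) :=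
  forall p : M,
    (exists X : 'I_r -> vectorField, indep_at p (A \o X)) /\
    (forall X : 'I_r.+1 -> vectorField, ~ indep_at p (A \o X)).

Record riemMetric := RiemMetric {
  riem_form :> vectorField -> vectorField -> C;
  riem_linear : forall f X Y Z,
    riem_form (f *: X + Y) Z = f * riem_form X Z + riem_form Y Z;
  riem_sym : forall X Y, riem_form X Y = riem_form Y X;
  riem_pos : forall p X, ~ vanishes_at p X -> 0 < riem_form X X p }.

(* [nabla X Y] is the covariant derivative of Y along X. *)
Record connection := Connection {
  nabla :> vectorField -> vectorField -> vectorField;
  nabla_linear : forall f X Y Z,
    nabla (f *: X + Y) Z = f *: nabla X Z + nabla Y Z;
  nabla_add : forall X Y Z, nabla X (Y + Z) = nabla X Y + nabla X Z;
  nabla_leibniz : forall f X Y, nabla X (f *: Y) = X f *: Y + f *: nabla X Y }.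

Implicit Type (D : connection).

Definition torsion D X Y := D X Y - D Y X - lie X Y.

Definition cov_form D (G : vectorField -> vectorField -> C) X Y Z :=
  X (G Y Z) - G (D X Y) Z - G Y (D X Z).

Definition cov_endo D (A : vectorField -> vectorField) X Y :=
  D X (A Y) - A (D X Y).

Definition levi_civita (g : riemMetric) D :=
  (forall X Y Z, cov_form D g X Y Z = 0) /\ (forall X Y, torsion D X Y = 0).

(* Tensorial form of the Einstein metricity condition; see einsteinP. *)
Definition einstein (G : vectorField -> vectorField -> C) D :=
  forall X Y Z, cov_form D G X Y Z = - G (torsion D X Y) Z.

(* Exterior derivatives without numerical factors; the brackets vanish on
   commuting fields. *)
Definition ext_d1 (w : vectorField -> C) X Y :=
  X (w Y) - Y (w X) - w (lie X Y).

Definition ext_d2 (w : vectorField -> vectorField -> C) X Y Z :=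
  X (w Y Z) + Y (w Z X) + Z (w X Y)
  - w (lie X Y) Z - w (lie Y Z) X - w (lie Z X) Y.

Definition totally_skew (T : vectorField -> vectorField -> vectorField -> C) :=
  forall X Y Z,
    [/\ T Y X Z = - T X Y Z, T X Z Y = - T X Y Z & T Z Y X = - T X Y Z].

Definition involutive_ker (w : vectorField -> C) :=
  forall X Y, w X = 0 -> w Y = 0 -> w (lie X Y) = 0.

Definition nijenhuis (A : vectorField -> vectorField) X Y :=
  lie (A X) (A Y) + A (A (lie X Y)) - A (lie (A X) Y) - A (lie X (A Y)).

Lemma riemDl (g : riemMetric) X Y Z : g (X + Y) Z = g X Z + g Y Z.
Proof. by rewrite -[X]scale1r riem_linear mul1r scale1r. Qed.

Lemma riemBl (g : riemMetric) X Y Z : g (X - Y) Z = g X Z - g Y Z.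
Proof. by rewrite addrC -scaleN1r riem_linear mulN1r addrC. Qed.

(* The exterior derivative of the dual form of xi in terms of the Levi-Civita
   connection. *)
Lemma ext_d1E (g : riemMetric) D (xi : vectorField) X Y : levi_civita g D ->
  ext_d1 (g^~ xi) X Y = g (D X xi) Y - g (D Y xi) X.
Proof.
move=> [gD tD]; have tE : lie X Y = D X Y - D Y X.
  by apply/esym/subr0_eq; exact: tD.
have dg (U V W : vectorField) : U (g V W) = g (D U V) W + g V (D U W).
  by apply/subr0_eq; rewrite opprD addrA; exact: gD.
rewrite /ext_d1 !dg tE riemBl [g Y (D X xi)]riem_sym.
by rewrite [g X (D Y xi)]riem_sym; ring.
Qed.

End VectorFields.

Record weakACM (R : realType) (m : nat) (M : manifold R m.*2.+1) := WeakACM {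
  acm_A : {linear vectorField M -> vectorField M};
  acm_Q : {linear vectorField M -> vectorField M};
  acm_xi : vectorField M;
  acm_eta : vectorField M -> smoothFun M;
  acm_g : riemMetric M;
  acm_A_skew : forall X Y, acm_g (acm_A X) Y = - acm_g X (acm_A Y);
  acm_A_rank : has_rank acm_A m.*2;
  acm_xi_unit : acm_g acm_xi acm_xi = 1;
  acm_etaE : forall X, acm_eta X = acm_g X acm_xi;
  acm_eta_xi : acm_eta acm_xi = 1;
  acm_Q_selfadj : forall X Y, acm_g (acm_Q X) Y = acm_g X (acm_Q Y);
  acm_Q_pos : forall p X, ~ vanishes_at p X -> 0 < acm_g (acm_Q X) X p;
  acm_A2 : forall X, acm_A (acm_A X) = - acm_Q X + acm_eta X *: acm_xi;
  acm_gAA : forall X Y,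
    acm_g (acm_A X) (acm_A Y) = acm_g (acm_Q X) Y - acm_eta X * acm_eta Y;
  acm_A_xi : acm_A acm_xi = 0;
  acm_Q_xi : acm_Q acm_xi = acm_xi }.

Section WeakACM.
Context {R : realType} {m : nat} {M : manifold R m.*2.+1}.
Variable S : weakACM M.
Local Notation A := (acm_A S).
Local Notation Q := (acm_Q S).
Local Notation xi := (acm_xi S).
Local Notation eta := (acm_eta S).
Local Notation g := (acm_g S).
Implicit Types X Y Z : vectorField M.

Definition acm_F X Y := g (A X) Y.

Definition acm_G X Y := g X Y + acm_F X Y.

Lemma acm_GDl X Y Z : acm_G (X + Y) Z = acm_G X Z + acm_G Y Z.
Proof. by rewrite /acm_G /acm_F raddfD !riemDl; ring. Qed.

(* For commuting X and Y this is the metricity condition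
   X (G Y Z) - G (D Y X) Z - G Y (D X Z) = 0. *)
Lemma einsteinP (D : connection M) : einstein acm_G D <->
  forall X Y Z,
    X (acm_G Y Z) - acm_G (D Y X + lie X Y) Z - acm_G Y (D X Z) = 0.
Proof.
have E X Y Z : cov_form D acm_G X Y Z + acm_G (torsion D X Y) Z =
    X (acm_G Y Z) - acm_G (D Y X + lie X Y) Z - acm_G Y (D X Z).
  have DE : D X Y = torsion D X Y + (D Y X + lie X Y).
    by rewrite /torsion -[_ - _ - _]addrA -opprD subrK.
  by rewrite /cov_form [in acm_G (D X Y)]DE acm_GDl; ring.
split=> H X Y Z; first by rewrite -E H addNr.
by apply/eqP; rewrite -addr_eq0 E H.
Qed.

Definition torsion3 (D : connection M) X Y Z := g (torsion D X Y) Z.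

Definition A_torsion_condition (D : connection M) := forall X Y Z,
  torsion3 D (A X) Y Z = torsion3 D X (A Y) Z /\
  torsion3 D X (A Y) Z = torsion3 D X Y (A Z).

Definition nijenhuis_wac X Y Z :=
  g (nijenhuis A X Y) Z + ext_d1 eta X Y * eta Z.

Definition acm_Qt X := Q X - X.
Local Notation Qt := acm_Qt.

(* The usual displayed formula for N^(5) omits the first summand. The remaining
   expression is not C^oo(M)-linear: replacing Y by f *: Y multiplies it by f
   and adds - X f * g (A Y) (Qt Z). Its values thus depend on the fields and
   not only on the vectors at a point, even for commuting fields. The first
   summand is what makes n5 a tensor. *)
Definition n5 X Y Z :=
  X (g (A Y) (Qt Z))
  + A Z (g X (Qt Y)) - A Y (g X (Qt Z))
  + g (lie X (A Z)) (Qt Y) - g (lie X (A Y)) (Qt Z)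
  + g (lie Y (A Z) - lie Z (A Y) - A (lie Y Z)) (Qt X).

End WeakACM.

(* Main.v *)
Require Import Defs.
From mathcomp Require Import all_boot all_order all_algebra.
From mathcomp Require Import all_classical all_reals all_analysis.
From mathcomp Require Import ring.
Import GRing.Theory.
Set Implicit Arguments.
Unset Strict Implicit.
Unset Printing Implicit Defensive.
Local Open Scope ring_scope.

(** Write T for the torsion, viewed both as a vector-valued form and as the
    3-form T(X,Y,Z) = g(T(X,Y),Z). The A-torsion condition says
    T(AX,Y) = T(X,AY) = -A T(X,Y); hence T(X,Y,AZ), T(X,Y,A^2 Z), and so on are
    again totally skew (twist_skew).

    The Einstein equation reads (nabla_X G)(Y,Z) = -T(X,Y,Z) + T(X,Y,AZ), whose
    right-hand side is skew in Y and Z. Its symmetric part is nabla g = 0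
    (einstein_metric), and its skew part, which concerns F, is
    (nabla_X A)Y = -T(X,Y) - A T(X,Y) (cov_A). Consequently nabla is the metric
    connection with skew torsion T, so nabla^g = nabla - T/2
    (skew_torsion_levi_civita).

    Positivity of Q forces ker A to be spanned by xi (acm_ker_A). Applied to
    T(X,xi), which A annihilates because A xi = 0, and to nabla_X xi, this gives
    T(.,xi) = 0 and nabla xi = 0, and therefore d eta = 0 and nabla^g xi = 0.

    Everything else is substitution. Writing brackets as
    [X,Y] = nabla_X Y - nabla_Y X - T(X,Y) and moving A across nabla and T:
    - N_A(X,Y) = 4 A T(X,Y) (nijenhuisE);
    - the two torsion terms in (nabla_X A)A + A(nabla_X A) cancel, so that
      nabla Q = 0 by Q = -A^2 + eta (x) xi, while T(X,QY) = Q T(X,Y) carries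
      this over to nabla^g (nabla_Q, torsion_Qr);
    - dF = -3 T (ext_d2_FE);
    - N5(X,Y,Z) = T(X,Y,Z) + T(X,AY,AZ) (n5E), which the previous formula turns
      into the stated expression in dF. *)

(** * Vector fields *)

Section VectorFieldAlgebra.
Context {R : realType} {n : nat} {M : manifold R n}.
Implicit Types (X Y Z : vectorField M) (f : smoothFun M).

Lemma smooth_mulr2_eq0 f : f *+ 2 = 0 -> f = 0.
Proof.
move=> f2; apply: smoothFunP => p.
have /eqP : (f *+ 2) p = 0 by rewrite f2.
by rewrite (_ : (f *+ 2) p = f p *+ 2) // Num.Theory.mulrn_eq0 /= => /eqP.
Qed.

Lemma vfDE X Y f : (X + Y) f = X f + Y f. Proof. by []. Qed.

Lemma vfNE X f : (- X) f = - X f. Proof. exact: mulN1r. Qed.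

Definition vfE := (vfDE, vfNE).

Lemma vf_mulr2_eq0 X : X *+ 2 = 0 -> X = 0.
Proof.
move=> X2; apply: vectorFieldP => f; apply: smooth_mulr2_eq0.
by rewrite mulr2n -vfDE -mulr2n X2.
Qed.

(** A derivation kills constants. *)
Lemma vf1 X : X 1 = 0.
Proof.
have := vf_leibniz X 1 1; rewrite mulr1 mul1r mulr1 => E.
by apply: (addrI (X 1)); rewrite addr0 -E.
Qed.

Lemma lieC X Y : lie Y X = - lie X Y.
Proof. by apply: vectorFieldP => f; rewrite vfNE /= opprB. Qed.

Lemma totally_skew_cycle (u : vectorField M -> vectorField M ->
    vectorField M -> smoothFun M) X Y Z :
  totally_skew u -> u Y Z X = u X Y Z.
Proof.
move=> sk; have [_ -> _] := sk Y X Z.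
by have [-> _ _] := sk X Y Z; rewrite opprK.
Qed.

End VectorFieldAlgebra.

(** * Metrics and metric connections *)

Section Metric.
Context {R : realType} {n : nat} {M : manifold R n}.
Variable g : riemMetric M.
Implicit Types (X Y Z : vectorField M) (f : smoothFun M) (D : connection M).

Lemma riemDr X Y Z : g X (Y + Z) = g X Y + g X Z.
Proof. by rewrite !(riem_sym g X) riemDl. Qed.

Lemma riem0l Z : g 0 Z = 0.
Proof. by rewrite -(subrr 0) riemBl subrr. Qed.

Lemma riemNl X Z : g (- X) Z = - g X Z.
Proof. by rewrite -sub0r riemBl riem0l sub0r. Qed.

Lemma riemNr X Z : g X (- Z) = - g X Z.
Proof. by rewrite !(riem_sym g X) riemNl. Qed.

Lemma riemZl f X Z : g (f *: X) Z = f * g X Z.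
Proof. by rewrite -[f *: X]addr0 riem_linear riem0l addr0. Qed.

Lemma riemZr f X Z : g X (f *: Z) = f * g X Z.
Proof. by rewrite !(riem_sym g X) riemZl. Qed.

Definition riemE := (@riemDl _ _ _ g, riemDr, riemNl, riemNr, riemZl, riemZr).

(** Definiteness is assumed pointwise and only gives that X vanishes at each
    point; a vector field is determined by its values because it is the
    derivation that it induces. *)
Lemma positive_eq0 (b : vectorField M -> smoothFun M) X :
  (forall p Y, ~ vanishes_at p Y -> (0 < b Y p)%O) -> b X = 0 -> X = 0.
Proof.
move=> b_pos bX0; apply: vectorFieldP => f; apply: smoothFunP => p.
have [X0|/b_pos] := pselect (vanishes_at p X); first exact: X0.
by rewrite bX0 Order.POrderTheory.ltxx.
Qed.

Lemma riem_inj X Y : (forall Z, g X Z = g Y Z) -> X = Y.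
Proof.
move=> gXY; apply/subr0_eq.
apply: (@positive_eq0 (fun X => g X X)); first exact: (@riem_pos _ _ _ g).
by rewrite riemBl gXY subrr.
Qed.

Lemma lieE D X Y : lie X Y = D X Y - D Y X - torsion D X Y.
Proof. by rewrite subKr. Qed.

Lemma torsionC D X Y : torsion D Y X = - torsion D X Y.
Proof. by apply: vectorFieldP => f; rewrite /torsion lieC !vfE; ring. Qed.

Lemma nabla0 D X : D X 0 = 0.
Proof. by apply: (addrI (D X 0)); rewrite -nabla_add !addr0. Qed.

Lemma nablaN D X Y : D X (- Y) = - D X Y.
Proof. by apply: (addIr (D X Y)); rewrite -nabla_add !addNr nabla0. Qed.

Lemma metricE D : (forall X Y Z, cov_form D g X Y Z = 0) ->
  forall X Y Z, X (g Y Z) = g (D X Y) Z + g Y (D X Z).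
Proof.
by move=> metric X Y Z; apply/subr0_eq; rewrite opprD addrA; exact: metric.
Qed.

(** Uniqueness of the metric connection with given torsion, in Koszul form: the
    difference s(X,Y,Z) = g(nabla_X Y - nabla^g_X Y, Z) is skew in Y, Z because
    both connections are metric, and its skew part in X, Y is the torsion, so
    2 s(X,Y,Z) = T(X,Y,Z) - T(Y,Z,X) + T(Z,X,Y). For a totally skew T the last
    two terms cancel. *)
Lemma skew_torsion_levi_civita D Dg :
    (forall X Y Z, cov_form D g X Y Z = 0) ->
    totally_skew (fun X Y Z => g (torsion D X Y) Z) -> levi_civita g Dg ->
  forall X Y, torsion D X Y = (D X Y - Dg X Y) *+ 2.
Proof.
move=> /metricE metric skT [/metricE Dg_metric Dg_free] X Y.
apply: riem_inj => Z; pose t U V W := g (torsion D U V) W.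
pose s U V W := g (D U V - Dg U V) W.
have sC U V W : s U W V = - s U V W.
  have := metric U V W; rewrite Dg_metric /s !riemBl !(riem_sym g _ V) => E.
  by apply/subr0_eq; rewrite -(subrr (g (Dg U V) W + g V (Dg U W))) {1}E; ring.
have sT U V W : t U V W = s U V W - s V U W.
  rewrite /t /s -riemBl; congr (g _ W).
  have /subr0_eq E := Dg_free U V; rewrite /torsion -E.
  by apply: vectorFieldP => f; rewrite !vfE; ring.
have cyc U V W : t U V W = t V W U.
  by rewrite [RHS](totally_skew_cycle _ _ _ skT).
have -> : g (torsion D X Y) Z = t X Y Z - t Y Z X + t Z X Y.
  by rewrite -(cyc X Y Z) -(cyc Z X Y) subrr add0r cyc.
by rewrite !sT (sC X Y Z) (sC Y X Z) (sC Z X Y) mulr2n riemDl /s; ring.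
Qed.

End Metric.

(** * Weak almost contact metric structures *)

Section WeakACMAlgebra.
Context {R : realType} {m : nat} {M : manifold R m.*2.+1}.
Variable S : weakACM M.
Local Notation A := (acm_A S).
Local Notation Q := (acm_Q S).
Local Notation Qt := (acm_Qt S).
Local Notation xi := (acm_xi S).
Local Notation eta := (acm_eta S).
Local Notation g := (acm_g S).
Implicit Types X Y Z : vectorField M.

(** The A-torsion condition for an arbitrary trilinear expression, so that it
    can be iterated along [twist_skew] and [twist_compatible]. *)
Definition A_compatible
    (u : vectorField M -> vectorField M -> vectorField M -> smoothFun M) :=
  forall X Y Z, u (A X) Y Z = u X (A Y) Z /\ u X (A Y) Z = u X Y (A Z).

(** If AX = 0 then A^2 = -Q + eta (x) xi gives QX = eta(X) xi, so the positive
    operator Q kills X - eta(X) xi. *)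
Lemma acm_ker_A X : A X = 0 -> X = eta X *: xi.
Proof.
move=> AX0; apply/subr0_eq.
apply: (@positive_eq0 _ _ _ (fun X => g (Q X) X)).
  exact: (@acm_Q_pos _ _ _ S).
have := acm_A2 S X; rewrite AX0 linear0 => /eqP.
rewrite eq_sym addrC subr_eq0 => /eqP QX.
by rewrite linearB linearZ /= acm_Q_xi QX subrr riem0l.
Qed.

Lemma acm_QE X : Q X = eta X *: xi - A (A X).
Proof. by rewrite acm_A2 opprD opprK addrCA subrr addr0. Qed.

Lemma acm_eta_A X : eta (A X) = 0.
Proof. by rewrite acm_etaE acm_A_skew acm_A_xi riem_sym riem0l oppr0. Qed.

Lemma acm_QtA X : Qt (A X) = A (Qt X).
Proof.
rewrite /acm_Qt linearB /= !acm_QE acm_eta_A scale0r sub0r.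
by rewrite linearB linearZ /= acm_A_xi scaler0 sub0r.
Qed.

Lemma acm_Qt_selfadj X Y : g (Qt X) Y = g X (Qt Y).
Proof. by rewrite /acm_Qt riemBl riemDr riemNr acm_Q_selfadj. Qed.

(** A transposition of two slots can be performed while A sits in the third one,
    and compatibility lets A be moved there first. *)
Lemma twist_skew u : A_compatible u -> totally_skew u ->
  totally_skew (fun X Y Z => u X Y (A Z)).
Proof.
move=> Au sk X Y Z; split; first by have [] := sk X Y (A Z).
- by have [_ <-] := Au X Z Y; have [_ -> _] := sk X Y (A Z).
- have [E1 E2] := Au Z Y X; rewrite -E2 -E1.
  by have [_ _ ->] := sk X Y (A Z).
Qed.

Lemma twist_compatible u : A_compatible u ->
  A_compatible (fun X Y Z => u X Y (A Z)).
Proof.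
by move=> Au X Y Z; have [-> _] := Au X Y (A Z); have [_ ->] := Au X Y (A Z).
Qed.

End WeakACMAlgebra.

(** * Einstein connections with totally skew torsion *)

Section EinsteinConnection.
Context {R : realType} {m : nat} {M : manifold R m.*2.+1}.
Variables (S : weakACM M) (D : connection M).
Local Notation A := (acm_A S).
Local Notation Q := (acm_Q S).
Local Notation Qt := (acm_Qt S).
Local Notation xi := (acm_xi S).
Local Notation eta := (acm_eta S).
Local Notation g := (acm_g S).
Local Notation T := (torsion D).
Local Notation t := (torsion3 S D).
Implicit Types X Y Z : vectorField M.

Hypothesis einsteinD : einstein (acm_G S) D.
Hypothesis skewT : totally_skew t.
Hypothesis AT : A_torsion_condition S D.

(* In this section [move: (T X Y) => U] hides the torsion before additive
   lemmas are used: it is by definition a difference, which rewriting with such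
   lemmas would unfold. *)

Lemma torsion_Al X Y : T (A X) Y = - A (T X Y).
Proof.
apply: (@riem_inj _ _ _ g) => Z; rewrite riemNl acm_A_skew opprK.
by have [E1 E2] := AT X Y Z; exact: etrans E1 E2.
Qed.

Lemma torsion_Ar X Y : T X (A Y) = - A (T X Y).
Proof.
apply: (@riem_inj _ _ _ g) => Z; rewrite riemNl acm_A_skew opprK.
by have [_] := AT X Y Z.
Qed.

(** A T(X,xi) = -T(X, A xi) = 0, so T(X,xi) is a multiple of xi; the coefficient
    T(X,xi,xi) vanishes by skewness. *)
Lemma torsion_xi X : T X xi = 0.
Proof.
have eta0 : eta (T X xi) = 0.
  apply: smooth_mulr2_eq0; have [_ E _] := skewT X xi xi.
  by rewrite acm_etaE -/(t X xi xi) mulr2n [in X in X + _]E addNr.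
rewrite (@acm_ker_A _ _ _ S (T X xi)) ?eta0 ?scale0r //.
apply: (@riem_inj _ _ _ g) => Z; rewrite riem0l acm_A_skew -/(t X xi (A Z)).
have [_ <-] := AT X xi Z; have [_ -> _] := skewT X Z (A xi).
by rewrite opprK acm_A_xi /torsion3 riem_sym riem0l.
Qed.

Lemma eta_torsion X Y : eta (T X Y) = 0.
Proof.
rewrite acm_etaE -/(t X Y xi).
by have [_ -> _] := skewT X xi Y; rewrite /torsion3 torsion_xi riem0l oppr0.
Qed.

(** Adding the Einstein equation to itself with Y and Z exchanged removes F on
    the left, and on the right both T(X,Y,Z) and T(X,Y,AZ) are skew in Y, Z. *)
Lemma einstein_metric X Y Z : cov_form D g X Y Z = 0.
Proof.
have covG U V W : cov_form D (acm_G S) U V W =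
    cov_form D g U V W + cov_form D (acm_F S) U V W.
  by rewrite /cov_form /acm_G vf_additiveD; ring.
have gC : cov_form D g X Z Y = cov_form D g X Y Z.
  by rewrite /cov_form !(riem_sym g _ Y) !(riem_sym g Z); ring.
have FC : cov_form D (acm_F S) X Z Y = - cov_form D (acm_F S) X Y Z.
  rewrite /cov_form /acm_F !(acm_A_skew S Z) !(acm_A_skew S (D X Z)).
  by rewrite !(riem_sym g _ (A Y)) (riem_sym g Z) raddfN /=; ring.
apply: smooth_mulr2_eq0.
have -> : cov_form D g X Y Z *+ 2 =
    cov_form D (acm_G S) X Y Z + cov_form D (acm_G S) X Z Y.
  by rewrite !covG gC FC mulr2n; ring.
rewrite !einsteinD /acm_G /acm_F !acm_A_skew -!/(t _ _ _).
have [_ <-] := AT X Z Y; have [_ -> _] := skewT X Y Z.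
by have [_ -> _] := skewT X Y (A Z); ring.
Qed.

(** Once g is parallel, (nabla_X G)(Y,Z) = (nabla_X F)(Y,Z) equals
    g((nabla_X A)Y, Z), and the Einstein equation can be solved for nabla A. *)
Lemma cov_A X Y : cov_endo D A X Y = - T X Y - A (T X Y).
Proof.
apply: (@riem_inj _ _ _ g) => Z; have := einsteinD X Y Z.
have := metricE einstein_metric X Y Z.
have := metricE einstein_metric X (A Y) Z.
rewrite /cov_form /cov_endo /acm_G /acm_F; move: (T X Y) => U.
rewrite vf_additiveD !riemE => -> -> /(congr1 -%R); rewrite opprK => E.
by rewrite -opprD -E; ring.
Qed.

Lemma nabla_A X Y : D X (A Y) = A (D X Y) - T X Y - A (T X Y).
Proof. by rewrite -addrA -cov_A addrCA subrr addr0. Qed.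

(** Differentiating A xi = 0 gives A(nabla_X xi) = 0 because (nabla_X A)xi only
    involves T(X,xi); differentiating g(xi,xi) = 1 removes the remaining
    component along xi. *)
Lemma nabla_xi X : D X xi = 0.
Proof.
rewrite (@acm_ker_A _ _ _ S (D X xi)).
  suff -> : eta (D X xi) = 0 by rewrite scale0r.
  apply: smooth_mulr2_eq0; rewrite acm_etaE mulr2n {2}riem_sym.
  by rewrite -(metricE einstein_metric) acm_xi_unit vf1.
have := cov_A X xi; rewrite /cov_endo acm_A_xi nabla0 torsion_xi !raddf0 sub0r.
by rewrite addr0 => /eqP; rewrite oppr_eq0 => /eqP.
Qed.

Lemma nabla_eta X Y : X (eta Y) = eta (D X Y).
Proof.
rewrite !acm_etaE (metricE einstein_metric) nabla_xi (riem_sym g Y) riem0l.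
by rewrite addr0.
Qed.

(** In D X (A (A Y)), moving D past the outer A leaves -T(X,AY) - A T(X,AY),
    which is A T + A^2 T; moving it past the inner A leaves -A T - A^2 T. *)
Lemma nabla_Q X Y : D X (Q Y) = Q (D X Y).
Proof.
rewrite !acm_QE nabla_add nabla_leibniz nablaN nabla_xi scaler0 addr0 nabla_eta.
congr (_ - _); rewrite (nabla_A X (A Y)) nabla_A torsion_Ar.
move: (T X Y) => U; rewrite !(raddfB A) (raddfN A).
by apply: vectorFieldP => f; rewrite !vfE; ring.
Qed.

Lemma nabla_Qt X Y : D X (Qt Y) = Qt (D X Y).
Proof. by rewrite /acm_Qt nabla_add nablaN nabla_Q. Qed.

(** On values of T, which are orthogonal to xi, Q is -A^2. The self-adjointness
    of Q moves it from the second slot to such a value. *)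
Lemma torsion_Qr X Y : T X (Q Y) = Q (T X Y).
Proof.
have QT U V : Q (T U V) = - T U (A (A V)).
  by rewrite !torsion_Ar (raddfN A) opprK acm_QE eta_torsion scale0r sub0r.
apply: (@riem_inj _ _ _ g) => Z; rewrite -/(t X (Q Y) Z).
have [_ -> _] := skewT X Z (Q Y); rewrite /torsion3 -acm_Q_selfadj !QT.
rewrite !riemNl opprK -!/(t _ _ _); have [_ -> _] := skewT X Y (A (A Z)).
by have [_ ->] := AT X (A Y) Z; have [_ ->] := AT X Y (A Z).
Qed.

Lemma ext_d1_eta X Y : ext_d1 eta X Y = 0.
Proof.
rewrite /ext_d1 (lieE D); have := eta_torsion X Y; move: (T X Y) => U.
by rewrite !nabla_eta !acm_etaE !riemBl => ->; rewrite subr0 subrr.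
Qed.

Lemma eta_involutive : involutive_ker eta.
Proof.
move=> X Y eX eY; have := ext_d1_eta X Y.
by rewrite /ext_d1 eX eY !raddf0 !add0r => /eqP; rewrite oppr_eq0 => /eqP.
Qed.

(** Each of the four brackets contributes -A^2 T through its torsion, and each
    of the four derivatives of A contributes A T + A^2 T. *)
Lemma nijenhuisE X Y : nijenhuis A X Y = A (T X Y) *+ 4.
Proof.
rewrite /nijenhuis !(lieE D) !nabla_A !torsion_Al !torsion_Ar (torsionC D X Y).
move: (T X Y) => U.
rewrite !(raddfB A) !(raddfN A).
by apply: vectorFieldP => f; rewrite 4!mulrS mulr0n addr0 !vfE; ring.
Qed.

Lemma nijenhuis_wacE X Y Z : nijenhuis_wac S X Y Z = - t X Y (A Z) *+ 4.
Proof.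
have gMn n U : g (U *+ n) Z = g U Z *+ n.
  by elim: n => [|n IH]; rewrite ?riem0l // !mulrS riemDl IH.
by rewrite /nijenhuis_wac ext_d1_eta mul0r addr0 nijenhuisE gMn acm_A_skew.
Qed.

Lemma twist_torsion_skew : totally_skew (fun X Y Z => t X Y (A Z)).
Proof. exact: twist_skew. Qed.

Lemma twist2_torsion_skew : totally_skew (fun X Y Z => t X (A Y) (A Z)).
Proof.
have sk := twist_skew (twist_compatible AT) twist_torsion_skew.
by move=> X Y Z; rewrite !(proj2 (AT _ _ (A _))); exact: sk.
Qed.

Lemma twist3_torsion_skew : totally_skew (fun X Y Z => t X (A Y) (A (A Z))).
Proof.
have A2 := twist_compatible (twist_compatible AT).
have sk := twist_skew A2 (twist_skew (twist_compatible AT) twist_torsion_skew).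
by move=> X Y Z; rewrite !(proj2 (AT _ _ (A (A _)))); exact: sk.
Qed.

(** The cyclic sum of (nabla_X F)(Y,Z) = -T(X,Y,Z) + T(X,Y,AZ) is
    -3 T(X,Y,Z) + 3 T(X,Y,AZ), and the brackets contribute the cyclic sum of
    F(T(X,Y),Z) = -T(X,Y,AZ). *)
Lemma ext_d2_FE X Y Z : ext_d2 (acm_F S) X Y Z = - t X Y Z *+ 3.
Proof.
have dF (U V W : vectorField M) : U (acm_F S V W) =
    acm_F S (D U V) W - acm_F S (D U W) V - t U V W + t U V (A W).
  rewrite /acm_F (metricE einstein_metric) nabla_A (acm_A_skew S V).
  rewrite (riem_sym g V) /torsion3; move: (T U V) => B.
  by rewrite !riemBl (acm_A_skew S B); ring.
have Fl U V W : acm_F S (lie U V) W =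
    acm_F S (D U V) W - acm_F S (D V U) W + t U V (A W).
  rewrite /acm_F (lieE D) /torsion3; move: (T U V) => B.
  by rewrite !(raddfB A) !riemBl (acm_A_skew S B) opprK.
rewrite /ext_d2 !dF !Fl (totally_skew_cycle X Y Z skewT).
rewrite (totally_skew_cycle Z X Y skewT).
rewrite (totally_skew_cycle X Y Z twist_torsion_skew).
by rewrite (totally_skew_cycle Z X Y twist_torsion_skew); ring.
Qed.

Lemma torsion_Qt X Y Z : g (T X Y) (Qt Z) = - t X Y Z - t X (A Y) (A Z).
Proof.
have [_ ->] := AT X Y (A Z); have := eta_torsion X Y.
rewrite /acm_Qt acm_QE acm_etaE /torsion3; move: (T X Y) => U Uxi.
by rewrite !riemE Uxi; ring.
Qed.

Lemma A_torsion_Qt X Y Z :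
  g (A (T X Y)) (Qt Z) = t X Y (A Z) + t X (A Y) (A (A Z)).
Proof. by rewrite acm_A_skew -acm_QtA torsion_Qt; ring. Qed.

(** Since g and Qt are parallel, all derivatives cancel except those of A, and
    what is left are values of the two forms g(T(U,V), Qt W) and
    g(A T(U,V), Qt W). Both are totally skew, so every term is a multiple of its
    value at (X,Y,Z): the second form cancels altogether and the first one
    survives with coefficient -1. *)
Lemma n5E X Y Z : n5 S X Y Z = t X Y Z + t X (A Y) (A Z).
Proof.
have skQ : totally_skew (fun U V W => g (T U V) (Qt W)).
  move=> U V W; have [e1 e2 e3] := skewT U V W.
  have [f1 f2 f3] := twist2_torsion_skew U V W.
  by rewrite !torsion_Qt e1 e2 e3 f1 f2 f3; split; ring.
have skAQ : totally_skew (fun U V W => g (A (T U V)) (Qt W)).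
  move=> U V W; have [e1 e2 e3] := twist_torsion_skew U V W.
  have [f1 f2 f3] := twist3_torsion_skew U V W.
  by rewrite !A_torsion_Qt e1 e2 e3 f1 f2 f3; split; ring.
have lieQ U V W : g (lie U V) W = g (D U V) W - g (D V U) W - g (T U V) W.
  by rewrite (lieE D); move: (T U V) => B; rewrite !riemBl.
have AlieQ U V W : g (A (lie U V)) W =
    g (A (D U V)) W - g (A (D V U)) W - g (A (T U V)) W.
  by rewrite (lieE D); move: (T U V) => B; rewrite !(raddfB A) !riemBl.
have nablaAQ U V W :
    g (D U (A V)) W = g (A (D U V)) W - g (T U V) W - g (A (T U V)) W.
  by rewrite nabla_A; move: (T U V) => B; rewrite !riemBl.
have AQC U V : g (A U) (Qt V) = - g (A V) (Qt U).
  by rewrite acm_A_skew -acm_QtA -acm_Qt_selfadj riem_sym.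
rewrite /n5 !(metricE einstein_metric) !nabla_Qt 2!riemBl AlieQ !lieQ !nablaAQ.
rewrite !torsion_Ar !riemNl (AQC Y (D X Z)) (AQC (D X Y) Z).
rewrite -!(acm_Qt_selfadj S X) !(riem_sym g (Qt X)).
have [_ e1 e2] := skQ X Y Z; have [_ f1 f2] := skAQ X Y Z.
rewrite e1 e2 (totally_skew_cycle X Y Z skQ).
by rewrite f1 f2 (totally_skew_cycle X Y Z skAQ) torsion_Qt; ring.
Qed.

End EinsteinConnection.

Theorem theorem3p18 (R : realType) (m : nat) (M : manifold R m.*2.+1)
    (S : weakACM M) (D : connection M) :
  einstein (acm_G S) D ->
  totally_skew (torsion3 S D) ->
  A_torsion_condition S D ->
  (involutive_ker (acm_eta S) /\
   (forall Dg : connection M, levi_civita (acm_g S) Dg ->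
      forall X, Dg X (acm_xi S) = 0)) /\
  (totally_skew (nijenhuis_wac S) /\
   (forall X Y, nijenhuis_wac S X Y (acm_xi S) = 0)) /\
  (totally_skew (n5 S) /\
   (forall X Y Z, n5 S X Y Z =
      - (3^-1 : R) *: ext_d2 (acm_F S) X Y Z
      - (3^-1 : R) *: ext_d2 (acm_F S) X (acm_A S Y) (acm_A S Z))) /\
  ((forall Dg : connection M, levi_civita (acm_g S) Dg ->
      forall X Y, cov_endo Dg (acm_Q S) X Y = 0) /\
   (forall X Y, cov_endo D (acm_Q S) X Y = 0)).
Proof.
move=> einD skT AT; have metric := einstein_metric einD skT AT.
have T2 Dg (LC : levi_civita (acm_g S) Dg) :=
  skew_torsion_levi_civita metric skT LC.
have wacE := nijenhuis_wacE einD skT AT.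
split; first split.
- exact: (eta_involutive einD skT AT).
- move=> Dg LC X; apply: vf_mulr2_eq0; have := T2 Dg LC X (acm_xi S).
  rewrite (torsion_xi skT AT) (nabla_xi einD skT AT) sub0r mulNrn => /esym/eqP.
  by rewrite oppr_eq0 => /eqP.
split; first split.
- move=> X Y Z; have [e1 e2 e3] := twist_torsion_skew skT AT X Y Z.
  by rewrite !wacE e1 e2 e3 !mulNrn.
- move=> X Y.
  by rewrite wacE acm_A_xi /torsion3 riem_sym riem0l oppr0 mul0rn.
split; first split.
- move=> X Y Z; have [e1 e2 e3] := skT X Y Z.
  have [f1 f2 f3] := twist2_torsion_skew skT AT X Y Z.
  by rewrite !(n5E einD skT AT) e1 e2 e3 f1 f2 f3 -!opprD.
- move=> X Y Z; rewrite (n5E einD skT AT) !(ext_d2_FE einD skT AT).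
  have third f : - (3^-1 : R) *: (- f *+ 3) = f :> smoothFun M.
    rewrite scaleNr mulNrn scalerN opprK -scalerMnr scalerMnl.
    by rewrite -(mulr_natr 3^-1) mulVf ?scale1r // Num.Theory.pnatr_eq0.
  by rewrite -scaleNr !third.
split.
- move=> Dg LC X Y; apply: vf_mulr2_eq0.
  have E U : Dg X U *+ 2 = D X U *+ 2 - torsion D X U.
    by rewrite (T2 Dg LC) mulrnBl subKr.
  rewrite /cov_endo mulrnBl -(raddfMn (acm_Q S)) !E (torsion_Qr skT AT).
  rewrite (nabla_Q einD skT AT); move: (torsion D X Y) => U.
  by rewrite raddfB raddfMn subrr.
- by move=> X Y; rewrite /cov_endo (nabla_Q einD skT AT) subrr.
Qed.
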